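(* Let $(x_s)_{s\in S}$ be a normalized family in a Banach space $X$ (i.e. $\|x_s\|=1$ for all $s\in S$). Assume that for every chain $\beta\in\mathcal{C}(S)$, the sequence $(x_s)_{s\in\beta}$ is weakly null. Then there exists a subtree $T$ of $S$ with the following property: for every $\delta>0$ there exists $C=C(\delta)>0$ such that for every chain $\beta=(s_i)_{i=1}^\infty$ of $T$, every $n\in\mathbb{N}$, all $a_1,\ldots,a_n\in[-1,1]$ and every $F\subseteq\{i\le n \mid |a_i|>\delta\}$, $$\Big\|\sum_{i\in F}a_ix_{s_i}\Big\|\le C(\delta)\Big\|\sum_{i=1}^na_ix_{s_i}\Big\|.$$ That is, for every chain $\beta\in\mathcal{C}(T)$ the sequence $(x_s)_{s\in\beta}$ is nearly unconditional, with constant $C=C(\delta)$ independent of the chain $\beta$.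
   Context: $S=\bigcup_{n=0}^\infty\{0,1\}^n$ is the dyadic tree of all finite sequences in $\{0,1\}$ (including the empty one), partially ordered by the initial segment relation $\le$. A subtree of $S$ is a subset $T\subseteq S$, with the induced order, which has a single minimal element and in which every element has exactly two immediate successors (i.e. for each $t\in T$ there are exactly two minimal elements of $\{t'\in T: t<t'\}$); thus $T$ is order isomorphic to $S$. A chain of a tree $T$ is an infinite linearly ordered subset of $T$; $\mathcal{C}(T)$ is the set of all chains of $T$. A chain is written $\beta=(s_i)_{i=1}^\infty$ with $s_1<s_2<\cdots$, and $(x_s)_{s\in\beta}$ denotes the sequence $(x_{s_i})_{i=1}^\infty$. A normalized sequence $(y_i)$ in a Banach space is nearly unconditional if for every $\delta>0$ there is $C=C(\delta)>0$ such that for every $n\in\mathbb{N}$, all $a_1,\ldots,a_n\in[-1,1]$ and every $F\subseteq\{i\le n\mid |a_i|>\delta\}$, $\|\sum_{i\in F}a_iy_i\|\le C(\delta)\|\sum_{i=1}^na_iy_i\|$. *)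

(* Defs.v *)
From HB Require Import structures.
From mathcomp Require Import all_boot all_order all_algebra.
From mathcomp Require Import all_classical all_reals all_analysis.

Set Implicit Arguments.
Unset Strict Implicit.
Unset Printing Implicit Defensive.

Import Order.TTheory GRing.Theory Num.Theory.
Import numFieldNormedType.Exports.

Local Open Scope classical_set_scope.
Local Open Scope ring_scope.

Notation dyadic := (seq bool).

Definition strict_prefix (s t : dyadic) : bool := prefix s t && (s != t).

Definition minimal_elements (A : set dyadic) : set dyadic :=
  [set s | A s /\ forall t, A t -> ~~ strict_prefix t s].

Definition immediate_successors (T : set dyadic) (t : dyadic) : set dyadic :=
  minimal_elements [set t' | T t' /\ strict_prefix t t'].

Definition subtree (T : set dyadic) : Prop :=
  (exists r, minimal_elements T = [set r]) /\
  (forall t, T t ->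
     exists u v, u <> v /\ immediate_successors T t = [set u; v]).

Definition chains (T : set dyadic) : set (set dyadic) :=
  [set beta | [/\ beta `<=` T, infinite_set beta &
                 total_on beta (fun s t => prefix s t)]].

(* [increasing_enum beta s] says that [beta] is listed as s 0 < s 1 < ...;
   each chain has exactly one such listing, since the elements of [dyadic]
   have finitely many predecessors. *)
Definition increasing_enum (beta : set dyadic) (s : nat -> dyadic) : Prop :=
  (forall i, strict_prefix (s i) (s i.+1)) /\ range s = beta.

Definition weakly_null (R : realType) (X : normedModType R) (y : nat -> X) :
    Prop :=
  forall f : {linear X -> R^o}, continuous f -> f (y n) @[n --> \oo] --> (0 : R^o).

(* Main.v *)
(* For a scale 2^j call a finite chain s critical when it is minimal, with
   respect to initial segments, among the chains admitting a functional f in the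
   dual ball with f(x_t) >= 0 on s and sum_s f(x_t) >= 2^j.  Critical chains form
   a thin family, so a Nash-Williams type theorem for chains of the dyadic tree
   applies to them.  By weak* compactness, weak nullness gives finite chains of
   candidate nodes such that any prescribed number of functionals are
   simultaneously small at one of the candidates; the Ramsey theorem makes the
   choice of the candidate independent of the future of the critical chain.  A
   fusion along the branches then yields T such that every critical chain s of
   scale 2^j lying on a path of T, past its first j nodes, has a witness that is
   summably small on the rest of the path past its first j nodes.

   Let lambda be the norm of sum a_i x_{s_i}.  Scale 1 (where the critical chains
   are the singletons) gives max |a_i| <= 2 lambda.  If a norming functional has
   sum sigma >= 2^(j+1) over the indices with a_i > delta where it is
   nonnegative, an initial segment of them past the first j nodes is critical of
   scale 2^j, and its witness gives delta 2^j <= lambda + j + 1.  Taking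
   2^(j+1) <= sigma < 2^(j+2), large j yields sigma <= 8 lambda / delta, while
   for bounded j the bound lambda >= delta / 2 suffices. *)

Require Import Defs.
From HB Require Import structures.
From mathcomp Require Import all_boot all_order all_algebra.
From mathcomp Require Import all_classical all_reals all_analysis.
From mathcomp Require Import zify ring lra.

Set Implicit Arguments.
Unset Strict Implicit.
Unset Printing Implicit Defensive.

Import Order.TTheory GRing.Theory Num.Theory.
Import numFieldNormedType.Exports.

Local Open Scope classical_set_scope.
Local Open Scope ring_scope.

(** * Perfect subsets of the dyadic tree *)

Lemma prefix_asym (s t : dyadic) : prefix s t -> prefix t s -> s = t.
Proof.
move=> /prefixP[u ->] /prefixP[v]; rewrite -catA.
by case: u => [|b u] => [|/(congr1 size)]; rewrite ?cats0 // size_cat /=; lia.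
Qed.

Lemma strict_prefix_trans : transitive strict_prefix.
Proof.
move=> t s u /andP[st snt] /andP[tu tnu]; apply/andP; split.
  exact: prefix_trans st tu.
by apply: contra snt => /eqP su; rewrite su in st *; rewrite (prefix_asym tu st).
Qed.

Lemma strict_prefix_irr : irreflexive strict_prefix.
Proof. by move=> s; rewrite /strict_prefix eqxx andbF. Qed.

Lemma strict_prefixW (s t : dyadic) : strict_prefix s t -> prefix s t.
Proof. by case/andP. Qed.

Lemma strict_prefix_lt_trans (s t u : dyadic) :
  prefix s t -> strict_prefix t u -> strict_prefix s u.
Proof.
have [->//|snt st] := eqVneq s t; apply: strict_prefix_trans.
by rewrite /strict_prefix st snt.
Qed.

Lemma lt_strict_prefix_trans (s t u : dyadic) :
  strict_prefix s t -> prefix t u -> strict_prefix s u.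
Proof.
have [->//|tnu st tu] := eqVneq t u; apply: strict_prefix_trans st _.
by rewrite /strict_prefix tu tnu.
Qed.

Lemma strict_prefix_rconsE (w u : dyadic) (b : bool) :
  strict_prefix w (rcons u b) = prefix w u.
Proof.
apply/idP/idP.
  move=> /andP[/prefixP[v]]; case/lastP: v => [|v c].
    by rewrite cats0 => ->; rewrite eqxx.
  by rewrite -rcons_cat => /rcons_inj[-> _] _; exact: prefix_prefix.
move=> wu; apply: strict_prefix_lt_trans wu _; rewrite /strict_prefix.
by rewrite prefix_rcons; apply/eqP => /(congr1 size); rewrite size_rcons; lia.
Qed.

Lemma prefix_comparable (u v w : dyadic) :
  prefix u w -> prefix v w -> prefix u v || prefix v u.
Proof.
rewrite !prefixE => /eqP eu /eqP ev.
have [le|/ltnW le] := leqP (size u) (size v).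
  by rewrite -[X in take _ X == u]ev take_takel // eu eqxx.
by rewrite -[X in take _ X == v]eu take_takel // ev eqxx orbT.
Qed.

Definition above (A : set dyadic) (t : dyadic) : set dyadic :=
  [set u | A u /\ strict_prefix t u].

(** Weaker than [subtree]: no root and no exact count of immediate successors is demanded. This form
    is stable under passing to [above A t] and under the partition lemma below, so it serves as the
    reservoir from which [fusion] picks a genuine subtree. *)
Definition perfect (A : set dyadic) : Prop :=
  A !=set0 /\ forall a, A a -> exists u v,
    [/\ above A a u, above A a v, ~~ prefix u v & ~~ prefix v u].

Lemma perfect_above A t : perfect A -> A t -> perfect (above A t).
Proof.
move=> [A0 pA] At; split.
  by have [u [v [Au _ _ _]]] := pA _ At; exists u.
move=> a [Aa ta]; have [u [v [[Au au] [Av av] uv vu]]] := pA _ Aa.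
exists u, v; split=> //; split=> //; split=> //.
  exact: strict_prefix_trans ta au.
exact: strict_prefix_trans ta av.
Qed.

Lemma prefix_mono_incomparable (u v u' v' : dyadic) :
  ~~ prefix u v -> ~~ prefix v u -> prefix u u' -> prefix v v' ->
  ~~ prefix u' v'.
Proof.
move=> uv vu uu' vv'; apply/negP => u'v'.
have := prefix_comparable (prefix_trans uu' u'v') vv'.
by rewrite (negbTE uv) (negbTE vu).
Qed.

Lemma perfect_setT : perfect setT.
Proof.
split=> [|a _]; first by exists [::].
exists (rcons a true), (rcons a false); split=> //=.
- by split=> //; rewrite strict_prefix_rconsE prefix_refl.
- by split=> //; rewrite strict_prefix_rconsE prefix_refl.
- apply/negP => /prefixP[v /(congr1 (nth true ^~ (size a)))].
  by rewrite nth_cat size_rcons ltnSn !nth_rcons ltnn eqxx.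
- apply/negP => /prefixP[v /(congr1 (nth true ^~ (size a)))].
  by rewrite nth_cat size_rcons ltnSn !nth_rcons ltnn eqxx.
Qed.

(** Either the part of [A] above some node misses [P] and is the required set, or every node of [A]
    has a node of [P] above it in [A]. In the second case incomparable successors can be pushed up
    into [P] and stay incomparable, so [A] intersected with [P] is perfect. *)
Lemma perfect_partition (A P : set dyadic) : perfect A ->
  exists U, [/\ perfect U, U `<=` A & U `<=` P \/ U `<=` ~` P].
Proof.
move=> pA.
have [[a [Aa aP]]|noa] := pselect (exists a, A a /\ above A a `<=` ~` P).
  exists (above A a); split; [exact: perfect_above|by move=> u []|by right].
have dense a : A a -> exists u, [/\ A u, strict_prefix a u & P u].
  move=> Aa; apply: contrapT => nu; apply: noa; exists a; split=> // u [Au au] Pu.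
  by apply: nu; exists u.
exists (A `&` P); split; [|by move=> u []|by left=> u []].
have [[a Aa] sA] := pA; split.
  by have [u [Au _ Pu]] := dense _ Aa; exists u.
move=> {Aa}a [Aa Pa]; have [u [v [[Au au] [Av av] uv vu]]] := sA _ Aa.
have [u' [Au' uu' Pu']] := dense _ Au.
have [v' [Av' vv' Pv']] := dense _ Av.
have /andP[uu'' _] := uu'; have /andP[vv'' _] := vv'.
exists u', v'; split.
- by split=> //; exact: strict_prefix_trans au uu'.
- by split=> //; exact: strict_prefix_trans av vv'.
- exact: prefix_mono_incomparable uv vu uu'' vv''.
- exact: prefix_mono_incomparable vu uv vv'' uu''.
Qed.

Definition chain_in (A : set dyadic) (s : seq dyadic) : Prop :=
  sorted strict_prefix s /\ forall t, t \in s -> A t.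

Lemma chain_inS (A B : set dyadic) s : A `<=` B -> chain_in A s -> chain_in B s.
Proof. by move=> AB [ss sA]; split=> // t /sA /AB. Qed.

Lemma chain_in_cons (A : set dyadic) t s :
  chain_in A (t :: s) <-> A t /\ chain_in (above A t) s.
Proof.
rewrite /chain_in /=; split.
  rewrite (path_sortedE strict_prefix_trans) => -[/andP[/allP ts ss] sA].
  split; first by apply: sA; rewrite mem_head.
  split=> // u us; split; last exact: ts.
  by apply: sA; rewrite in_cons us orbT.
move=> [At [ss sA]]; split; last first.
  by move=> u; rewrite in_cons => /predU1P[->//|/sA[]].
rewrite (path_sortedE strict_prefix_trans) ss andbT.
by apply/allP => u /sA[].
Qed.

(** * Fusion along branches *)

Lemma sorted_sub_subseq (s p : seq dyadic) :
  sorted strict_prefix s -> sorted strict_prefix p -> {subset s <= p} ->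
  subseq s p.
Proof.
move=> ss sp sub; suff -> : s = [seq t <- p | t \in s] by exact: filter_subseq.
apply: (irr_sorted_eq strict_prefix_trans strict_prefix_irr) => //.
  exact: (sorted_filter strict_prefix_trans).
by move=> t; rewrite mem_filter; case: (boolP (t \in s)) => // /sub ->.
Qed.

Lemma sorted_rconsE (s : seq dyadic) t : sorted strict_prefix (rcons s t) =
  all (strict_prefix^~ t) s && sorted strict_prefix s.
Proof. by rewrite !(sorted_pairwise strict_prefix_trans) pairwise_rcons. Qed.

Lemma sorted_le_last (s : seq dyadic) t u : sorted strict_prefix s -> t \in s ->
  prefix t (last u s).
Proof.
case/lastP: s => [//|s v]; rewrite last_rcons mem_rcons in_cons sorted_rconsE.
move=> /andP[/allP sv _] /predU1P[->|/sv/strict_prefixW//]; exact: prefix_refl.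
Qed.

(** * Embeddings of the dyadic tree into itself *)

Section Embedding.
Variables (e : dyadic -> dyadic).
Hypothesis e_lt : forall u b, strict_prefix (e u) (e (rcons u b)).
Hypothesis e_incomp : forall u b v w,
  ~~ prefix (e (u ++ b :: v)) (e (u ++ ~~ b :: w)).

Lemma embedding_le u v : prefix (e u) (e (u ++ v)).
Proof.
elim/last_ind: v => [|v b IH]; first by rewrite cats0 prefix_refl.
by rewrite -rcons_cat; apply: prefix_trans IH _; exact: strict_prefixW.
Qed.

Lemma embedding_mono u v : strict_prefix u v -> strict_prefix (e u) (e v).
Proof.
case/andP=> /prefixP[[|b w] ->]; first by rewrite cats0 eqxx.
move=> _; rewrite -cat_rcons.
by apply: lt_strict_prefix_trans (e_lt _ b) (embedding_le _ _).
Qed.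

Lemma dyadic_split (u v : dyadic) : [\/ prefix u v, prefix v u |
  exists w b u' v', u = w ++ b :: u' /\ v = w ++ ~~ b :: v'].
Proof.
elim: u v => [|b u IH] [|c v]; [exact: Or31|exact: Or31|exact: Or32|].
have [->|bc] := eqVneq b c.
  case: (IH v) => [uv|vu|[w [d [u' [v' [-> ->]]]]]].
  - by apply: Or31; rewrite prefix_cons eqxx.
  - by apply: Or32; rewrite prefix_cons eqxx.
  - by apply: Or33; exists (c :: w), d, u', v'.
apply: Or33; exists [::], b, u, v; split=> //=.
by congr (_ :: _); case: b c bc => [] [].
Qed.

Lemma embedding_prefix u v : prefix (e u) (e v) = prefix u v.
Proof.
apply/idP/idP; last first.
  by move=> /prefixP[w ->]; exact: embedding_le.
case: (dyadic_split u v) => [//|vu|[w [b [u' [v' [-> ->]]]]]]; last first.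
  by rewrite (negbTE (e_incomp _ _ _ _)).
have [->|nvu euv] := eqVneq v u; first by rewrite !prefix_refl.
have : strict_prefix v u by rewrite /strict_prefix vu nvu.
move=> /embedding_mono/andP[evu] /eqP[].
exact: prefix_asym evu euv.
Qed.

Lemma embedding_inj : injective e.
Proof.
move=> u v euv; apply: prefix_asym; by rewrite -embedding_prefix euv prefix_refl.
Qed.

Lemma embedding_lt u v : strict_prefix (e u) (e v) = strict_prefix u v.
Proof. by rewrite /strict_prefix embedding_prefix (inj_eq embedding_inj). Qed.

Lemma prefix_rcons_step (u v : dyadic) :
  strict_prefix u v -> exists b, prefix (rcons u b) v.
Proof.
case/andP=> /prefixP[[|b w] ->]; first by rewrite cats0 eqxx.
by exists b; rewrite -cat_rcons prefix_prefix.
Qed.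

Lemma embedding_perfect : perfect (range e).
Proof.
split; first by exists (e [::]), [::].
move=> _ [u _ <-]; exists (e (rcons u true)), (e (rcons u false)).
split; rewrite ?embedding_prefix.
- by split=> //; exists (rcons u true).
- by split=> //; exists (rcons u false).
- by rewrite -!cats1 prefix_catr ?eqxx.
- by rewrite -!cats1 prefix_catr ?eqxx.
Qed.

Lemma embedding_subtree : subtree (range e).
Proof.
split.
  exists (e [::]); apply/seteqP; split=> [_ [[u _ <-] umin]|_ ->] /=.
    case: u umin => [//|b u] umin.
    have := umin (e [::]) (ex_intro2 _ _ [::] I erefl).
    by rewrite embedding_lt /strict_prefix prefix0s.
  split=> [|_ [u _ <-]]; first by exists [::].
  by rewrite embedding_lt /strict_prefix prefixs0 andbN.
move=> _ [u _ <-]; exists (e (rcons u true)), (e (rcons u false)); split.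
  by move=> /embedding_inj /rcons_inj[].
apply/seteqP; split=> [_ [[[v _ <-]]]|_ [] ->] /=.
- rewrite embedding_lt => uv vmin; have [b bv] := prefix_rcons_step uv.
  have := vmin (e (rcons u b)) (conj (ex_intro2 _ _ _ I erefl) (e_lt _ _)).
  rewrite embedding_lt /strict_prefix bv negbK => /eqP <-.
  by case: b {bv}; [left|right].
- split=> [|_ [[v _ <-]]]; first by split=> //; exists (rcons u true).
  rewrite !embedding_lt => uv; apply/negP; rewrite strict_prefix_rconsE => vu.
  by have := lt_strict_prefix_trans uv vu; rewrite strict_prefix_irr.
- split=> [|_ [[v _ <-]]]; first by split=> //; exists (rcons u false).
  rewrite !embedding_lt => uv; apply/negP; rewrite strict_prefix_rconsE => vu.
  by have := lt_strict_prefix_trans uv vu; rewrite strict_prefix_irr.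
Qed.

End Embedding.

(** One round of the fusion: [r.1.1] is the new node, [r.1.2] the reservoir left above it, and [r.2]
    gives two mutually incomparable halves of that reservoir, one for each child. The assumptions on
    [A] stand under the existential so that [choice] yields a total function of the state. *)
Lemma fusion_split (P : seq dyadic -> set dyadic -> Prop) (p : seq dyadic)
    (A : set dyadic) :
  (forall q B, perfect B -> P q B -> exists t C,
     [/\ B t, perfect C, C `<=` above B t & P (rcons q t) C]) ->
  (forall q B C, P q B -> perfect C -> C `<=` B -> P q C) ->
  exists (r : dyadic * set dyadic * (bool -> set dyadic)),
    perfect A -> P p A -> [/\ A r.1.1, r.1.2 `<=` above A r.1.1,
      P (rcons p r.1.1) r.1.2,
      forall b, [/\ perfect (r.2 b), r.2 b `<=` r.1.2 &
                   P (rcons p r.1.1) (r.2 b)] &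
      forall b x y, r.2 b x -> r.2 (~~ b) y -> ~~ prefix x y].
Proof.
move=> step her.
have [[pA PA]|nPA] := pselect (perfect A /\ P p A); last first.
  by exists ([::], set0, fun=> set0) => pA PA; case: nPA.
have [t [C [At pC CA PC]]] := step _ _ pA PA.
have [[c Cc] sC] := pC; have [u [v [[Cu cu] [Cv cv] uv vu]]] := sC _ Cc.
have pu := perfect_above pC Cu; have pv := perfect_above pC Cv.
exists (t, C, fun b => if b then above C u else above C v) => _ _; split=> //=.
- case; split=> //; try by [move=> x []].
  + by apply: her PC pu _ => x [].
  + by apply: her PC pv _ => x [].
- case=> x y /= [_ /andP[ax _]] [_ /andP[ay _]].
    exact: prefix_mono_incomparable uv vu ax ay.
  exact: prefix_mono_incomparable vu uv ax ay.
Qed.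

(** Read [P q B] as: [q] lists the nodes committed so far along a branch, and [B] is the reservoir
    for later ones. Running the step at every dyadic word, separately in the two halves, gives an
    embedding whose range is [T]. A chain of [T] need not be an initial part of a branch, hence the
    path [p] containing it. *)
Lemma fusion (P : seq dyadic -> set dyadic -> Prop) (A : set dyadic) :
  (forall q B, perfect B -> P q B -> exists t C,
     [/\ B t, perfect C, C `<=` above B t & P (rcons q t) C]) ->
  (forall q B C, P q B -> perfect C -> C `<=` B -> P q C) ->
  perfect A -> P [::] A ->
  exists T, [/\ T `<=` A, perfect T, subtree T &
    forall s, chain_in T s -> s <> [::] ->
      exists p, [/\ sorted strict_prefix p, subseq s p &
                 P p (above T (last [::] s))]].
Proof.
move=> step her pA PA.
pose ok (st : seq dyadic * set dyadic) (r : dyadic * set dyadic * (bool -> set dyadic)) :=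
    perfect st.2 -> P st.1 st.2 -> [/\ st.2 r.1.1, r.1.2 `<=` above st.2 r.1.1,
      P (rcons st.1 r.1.1) r.1.2,
      forall b, [/\ perfect (r.2 b), r.2 b `<=` r.1.2 &
                   P (rcons st.1 r.1.1) (r.2 b)] &
      forall b x y, r.2 b x -> r.2 (~~ b) y -> ~~ prefix x y].
have /choice[g gP] : forall st, exists r, ok st r.
  by move=> [q B]; exact: fusion_split.
pose next st b := (rcons st.1 (g st).1.1, (g st).2 b).
pose state (u : dyadic) := foldl next ([::], A) u.
have state_rcons u b : state (rcons u b) = next (state u) b.
  by rewrite /state foldl_rcons.
have state_ok u : perfect (state u).2 /\ P (state u).1 (state u).2.
  elim/last_ind: u => [//|u b [pu Pu]]; rewrite state_rcons /=.
  by have [_ _ _ /(_ b)[]] := gP _ pu Pu.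
pose e u := (g (state u)).1.1.
have eA u : (state u).2 (e u).
  by have [pu Pu] := state_ok u; have [] := gP _ pu Pu.
have sub1 u b : (state (rcons u b)).2 `<=` (g (state u)).1.2.
  have [pu Pu] := state_ok u; rewrite state_rcons.
  by have [_ _ _ /(_ b)[]] := gP _ pu Pu.
have sub2 u : (g (state u)).1.2 `<=` above (state u).2 (e u).
  by have [pu Pu] := state_ok u; have [] := gP _ pu Pu.
have mono u v : (state (u ++ v)).2 `<=` (state u).2.
  elim/last_ind: v => [|v b IH]; first by rewrite cats0.
  by rewrite -rcons_cat => x /sub1/sub2[/IH].
have e_lt u b : strict_prefix (e u) (e (rcons u b)).
  by have /sub1/sub2[] := eA (rcons u b).
have e_incomp u b v w : ~~ prefix (e (u ++ b :: v)) (e (u ++ ~~ b :: w)).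
  have [pu Pu] := state_ok u; have [_ _ _ _ H] := gP _ pu Pu.
  have:= eA (u ++ b :: v); rewrite -cat_rcons => /mono; rewrite state_rcons => h1.
  have:= eA (u ++ ~~ b :: w); rewrite -cat_rcons => /mono; rewrite state_rcons => h2.
  exact: (H b).
(* The list stored at [u] consists of the images of the strict prefixes of [u], so it is the path of
   [T] leading to [e u], without [e u] itself. *)
have e_path u : sorted strict_prefix (state u).1 /\
    forall t, t \in (state u).1 <-> exists2 w, strict_prefix w u & t = e w.
  elim/last_ind: u => [|u b [su memu]].
    split=> // t; split=> // -[w] /andP[]; rewrite prefixs0 => /eqP ->.
    by rewrite eqxx.
  rewrite state_rcons /=; split.
    rewrite sorted_rconsE su andbT; apply/allP => t /memu[w wu ->].
    exact: embedding_mono e_lt _ _ wu.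
  move=> t; rewrite mem_rcons in_cons; split.
    move=> /predU1P[->|/memu[w wu ->]].
      by exists u => //; rewrite strict_prefix_rconsE prefix_refl.
    by exists w => //; rewrite strict_prefix_rconsE; exact: strict_prefixW.
  move=> [w]; rewrite strict_prefix_rconsE => wu ->.
  have [->|nwu] := eqVneq w u; first by rewrite eqxx.
  apply/orP; right; apply/memu; exists w => //.
  by rewrite /strict_prefix wu nwu.
exists (range e); split.
- by move=> _ [u _ <-]; apply: (mono [::]); exact: eA.
- exact: embedding_perfect.
- exact: embedding_subtree.
move=> s [ss sT] s0.
have [v _ ev] : range e (last [::] s).
  by apply: sT; case: s s0 {ss} => //= a s _; exact: mem_last.
(* Passing to a child of [v] adds [e v], the last node of [s], to the list. Both children share this
   list, and [P] is taken for the reservoir before it is halved, which contains everything of [T]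
   above [e v]. *)
exists (state (rcons v true)).1; have [sv memv] := e_path (rcons v true).
split=> //.
  apply: sorted_sub_subseq => // t ts; apply/memv.
  have [w _ ew] := sT _ ts; exists w => //; rewrite strict_prefix_rconsE.
  rewrite -(embedding_prefix e_lt e_incomp) ew ev.
  exact: sorted_le_last.
rewrite state_rcons /=; have [pv Pv] := state_ok v; have [_ _ H _ _] := gP _ pv Pv.
apply: her H _ _.
  by apply: perfect_above; [exact: embedding_perfect|rewrite -ev; exists v].
move=> _ [[w _ <-]]; rewrite -ev (embedding_lt e_lt e_incomp) => /prefix_rcons_step[b].
move=> /prefixP[z ->]; apply: (sub1 v b); apply: mono; exact: eA.
Qed.

(** * A Ramsey theorem for chains *)

Definition thin (B : seq dyadic -> Prop) : Prop :=
  forall s s', B s -> B (s ++ s') -> s' = [::].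

Section Ramsey.
Variables (B G : seq dyadic -> Prop).
Hypothesis thinB : thin B.

Definition accepts (A : set dyadic) (s : seq dyadic) : Prop :=
  forall s', chain_in A s' -> B (s ++ s') -> G (s ++ s').

Definition rejects (A : set dyadic) (s : seq dyadic) : Prop :=
  forall A', perfect A' -> A' `<=` A -> ~ accepts A' s.

Lemma accepts_sub A A' s : A' `<=` A -> accepts A s -> accepts A' s.
Proof. by move=> sub acc s' /(chain_inS sub); exact: acc. Qed.

Lemma rejects_sub A A' s : A' `<=` A -> rejects A s -> rejects A' s.
Proof. by move=> sub rej A'' p'' sub'; apply: rej => // x /sub' /sub. Qed.

Lemma chain_in1 (A : set dyadic) t : A t -> chain_in A [:: t].
Proof. by move=> At; split=> // u; rewrite inE => /eqP ->. Qed.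

Lemma aboveS (A A' : set dyadic) t : A `<=` A' -> above A t `<=` above A' t.
Proof. by move=> sub u [/sub]. Qed.

(** A fusion makes the tree above each node [t] decide [rcons s t], and a partition makes the
    decision uniform. Uniform acceptance would make a perfect subset of [A] accept [s], since
    [~ B s] rules out the empty continuation. *)
Lemma rejects_step A s : perfect A -> rejects A s -> ~ B s ->
  exists U, [/\ perfect U, U `<=` A &
    forall u, U u -> rejects (above U u) (rcons s u)].
Proof.
move=> pA rej nBs.
pose P (p : seq dyadic) (D : set dyadic) := forall t, t \in p ->
  accepts D (rcons s t) \/ rejects D (rcons s t).
have Psub q D D' : P q D -> perfect D' -> D' `<=` D -> P q D'.
  move=> PD _ sub t /PD[acc|rj]; [left; exact: accepts_sub acc|].
  by right; exact: rejects_sub rj.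
have [||T [TA pT _ Tpath]] := @fusion P A _ Psub pA; [|by []|].
  move=> q D pD PD; have [[t Dt] _] := pD.
  have ptD := perfect_above pD Dt.
  have [[C [pC CD acc]]|nacc] := pselect (exists C,
      [/\ perfect C, C `<=` above D t & accepts C (rcons s t)]).
    exists t, C; split=> // u; rewrite mem_rcons in_cons => /predU1P[->|uq].
      by left.
    by apply: Psub PD pC _ u uq => x /CD[].
  exists t, (above D t); split=> // u; rewrite mem_rcons in_cons.
  move=> /predU1P[->|uq].
    by right=> C pC CD acc; apply: nacc; exists C.
  by apply: Psub PD ptD _ u uq => x [].
have [U [pU UT [Uacc|Unacc]]] :=
    perfect_partition [set t | accepts (above T t) (rcons s t)] pT.
  exfalso; apply: (rej U pU) => [x /UT/TA//|[|t s']].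
    by rewrite cats0 => _ /nBs.
  move=> /chain_in_cons[Ut /(chain_inS (aboveS UT)) cs'].
  by rewrite -cat_rcons; exact: Uacc Ut _ cs'.
exists U; split=> // [x /UT/TA//|u Uu].
have [||p [_ sub Pp]] := Tpath [:: u]; [exact: chain_in1 (UT _ Uu)|by []|].
have [||] := Pp u; first by apply: (mem_subseq sub); rewrite mem_head.
  by move=> acc; case: (Unacc u Uu).
by apply: rejects_sub; exact: aboveS.
Qed.

Lemma rejects_steps A (l : seq (seq dyadic)) : perfect A ->
  (forall s, s \in l -> rejects A s /\ ~ B s) ->
  exists U, [/\ perfect U, U `<=` A &
    forall s u, s \in l -> U u -> rejects (above U u) (rcons s u)].
Proof.
move=> pA; elim: l => [_|s l IH rl].
  by exists A; split=> // s u; rewrite in_nil.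
have [|U [pU UA Ul]] := IH; first by move=> s' ls'; apply: rl; rewrite in_cons ls' orbT.
have [rs nBs] := rl s (mem_head _ _).
have [V [pV VU Vs]] := rejects_step pU (rejects_sub UA rs) nBs.
exists V; split=> // [x /VU/UA//|s' u]; rewrite in_cons => /predU1P[->|ls'] Vu.
  exact: Vs.
by apply: rejects_sub (Ul _ _ ls' (VU _ Vu)); exact: aboveS.
Qed.

Lemma subseq_rcons (T : eqType) (s p : seq T) x : subseq s (rcons p x) ->
  subseq s p \/ exists2 s', s = rcons s' x & subseq s' p.
Proof.
case/lastP: s => [|s y]; first by left; exact: sub0seq.
rewrite -subseq_rev !rev_rcons /=; case: eqVneq => [->|_].
  by rewrite subseq_rev => sp; right; exists s.
by rewrite -rev_rcons subseq_rev; left.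
Qed.

Definition subseqs (T : eqType) (p : seq T) : seq (seq T) :=
  [seq mask (val m) p | m <- enum {: (size p).-tuple bool}].

Lemma mem_subseqs (T : eqType) (s p : seq T) : (s \in subseqs p) = subseq s p.
Proof.
apply/mapP/subseqP => [[m _ ->]|[m sm ->]].
  by exists (val m); rewrite ?size_tuple.
exists (tcast sm (in_tuple m)); first by rewrite mem_enum.
by rewrite /= val_tcast.
Qed.

(* The accept/reject argument of Galvin and Prikry, run along the branches of
   the tree. *)
Lemma chain_ramsey A : perfect A -> exists U, [/\ perfect U, U `<=` A &
  (forall s, chain_in U s -> B s -> G s) \/
  (forall s, chain_in U s -> B s -> ~ G s)].
Proof.
move=> pA.
(* If [B] holds of the empty chain, thinness leaves no other chain in [B]. *)
have [B0|nB0] := pselect (B [::]).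
  exists A; split=> //; have [G0|nG0] := pselect (G [::]); [left|right];
    by move=> s _ Bs; rewrite (thinB (s' := s) B0).
have [[U [pU UA acc]]|nacc] := pselect (exists U,
    [/\ perfect U, U `<=` A & accepts U [::]]).
  by exists U; split=> //; left.
(* The fusion keeps rejected every subsequence of the path with no proper initial segment in [B];
   the subsequence itself may lie in [B]. *)
pose P (p : seq dyadic) (D : set dyadic) := forall s, subseq s p ->
  (forall s1 s2, s = s1 ++ s2 -> s2 <> [::] -> ~ B s1) -> rejects D s.
have Psub q D D' : P q D -> perfect D' -> D' `<=` D -> P q D'.
  by move=> PD _ sub s sq nB; exact: rejects_sub (PD s sq nB).
have [||T [TA pT _ Tpath]] := @fusion P A _ Psub pA.
- move=> q D pD PD.
  (* Here [s2] may be empty: only subsequences outside [B] are extended by a new node, as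
     [rejects_steps] requires. *)
  pose l := [seq s <- subseqs q |
    `[< (forall s1 s2, s = s1 ++ s2 -> ~ B s1) >]].
  have [s|U [pU UD Ul]] := @rejects_steps D l pD.
    rewrite mem_filter mem_subseqs => /andP[/asboolP nB sq]; split.
      by apply: PD => // s1 s2 e _; exact: nB e.
    by apply: (nB s [::]); rewrite cats0.
  have [[u Uu] _] := pU; exists u, (above U u); split; first exact: UD.
  + exact: perfect_above.
  + exact: aboveS.
  move=> s /subseq_rcons[sq nB|[s' -> sq] nB].
    by apply: rejects_sub (PD _ sq nB) => x [/UD].
  apply: Ul => //; rewrite mem_filter mem_subseqs sq andbT; apply/asboolP.
  move=> s1 s2 e; apply: (nB s1 (rcons s2 u)); last by case: (s2).
  by rewrite e rcons_cat.
- move=> s; rewrite subseq0 => /eqP -> _ U pU UA acc.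
  by apply: nacc; exists U.
(* A chain in both [B] and [G] is rejected by the tree above it, yet also accepted by it, because
   thinness leaves only the empty continuation. *)
exists T; split=> //; right=> s cs Bs Gs.
have s0 : s <> [::] by move=> s0; rewrite s0 in Bs.
have [p [_ sp Pp]] := Tpath s cs s0.
apply: (Pp s sp _ (above T (last [::] s)) _ _ _) => //.
- by move=> s1 s2 e s20 Bs1; apply: s20; apply: thinB Bs1 _; rewrite -e.
- apply: perfect_above => //; case: cs => _; apply.
  by case: (s) s0 => //= a s' _; exact: mem_last.
by move=> s' _ Bs'; rewrite (thinB Bs Bs') cats0.
Qed.

End Ramsey.

Lemma chain_ramsey_seq (J : eqType) (l : seq J) (B G : J -> seq dyadic -> Prop) A :
  (forall j, j \in l -> thin (B j)) -> perfect A ->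
  exists U, [/\ perfect U, U `<=` A & forall j, j \in l ->
    (forall s, chain_in U s -> B j s -> G j s) \/
    (forall s, chain_in U s -> B j s -> ~ G j s)].
Proof.
move=> + pA; elim: l => [_|j l IH thl].
  by exists A; split=> // j; rewrite in_nil.
have [|U [pU UA Ul]] := IH; first by move=> i il; apply: thl; rewrite in_cons il orbT.
have [V [pV VU Vj]] := chain_ramsey (G j) (thl j (mem_head _ _)) pU.
exists V; split=> // [x /VU/UA//|i]; rewrite in_cons => /predU1P[->//|/Ul].
by case=> H; [left|right] => s /(chain_inS VU); exact: H.
Qed.

(** * Norming functionals *)

Section HahnBanach.
Variables (R : realType) (X : normedModType R).
Implicit Types (p q : X -> R) (y z : X).

Definition sublinear p : Prop :=
  (forall y z, p (y + z) <= p y + p z) /\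
  (forall c y, 0 < c -> p (c *: y) = c * p y).

Lemma sublinear0 p : sublinear p -> p 0 = 0.
Proof.
by move=> [_ /(_ 2 0 (ltr0n _ 2))]; rewrite scaler0; lra.
Qed.

Lemma sublinear_opp_ge p y : sublinear p -> - p (- y) <= p y.
Proof.
by move=> sp; have := sp.1 y (- y); rewrite subrr sublinear0 //; lra.
Qed.

(** The pointwise infimum of a family is sublinear when subadditivity and homogeneity hold up to a
    change of index. It is used for the one-parameter family in [sublinear_descent] and for the
    chains in Zorn's lemma. *)
Lemma sublinear_inf (I : Type) (D : set I) (g : I -> X -> R) (m : X -> R) :
  D !=set0 -> (forall i y, D i -> m y <= g i y) ->
  (forall i j y z, D i -> D j ->
     exists2 k, D k & g k (y + z) <= g i y + g j z) ->
  (forall i c y, D i -> 0 < c -> exists2 k, D k & g k (c *: y) <= c * g i y) ->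
  exists q, sublinear q /\ forall i y, D i -> q y <= g i y.
Proof.
move=> [i0 Di0] mg gD gZ.
pose E y := [set g i y | i in D].
have lbE y : has_lbound (E y) by exists (m y) => _ [i Di <-]; exact: mg.
have E0 y : E y !=set0 by exists (g i0 y), i0.
pose q y := inf (E y).
have qle i y : D i -> q y <= g i y by move=> Di; apply: ge_inf => //; exists i.
have qZ c y : 0 < c -> q (c *: y) <= c * q y.
  move=> c0; rewrite mulrC -ler_pdivrMr //; apply: (lb_le_inf (E0 y)) => _ [i Di <-].
  rewrite ler_pdivrMr // mulrC; have [k Dk] := gZ _ _ y Di c0.
  by apply: le_trans; exact: qle.
exists q; split=> //; split=> [y z|c y c0].
  rewrite -lerBlDr; apply: (lb_le_inf (E0 y)) => _ [i Di <-].
  rewrite lerBlDr -lerBlDl; apply: (lb_le_inf (E0 z)) => _ [j Dj <-].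
  rewrite lerBlDl; have [k Dk] := gD _ _ y z Di Dj.
  by apply: le_trans; exact: qle.
apply/eqP; rewrite eq_le qZ //=; have := qZ c^-1 (c *: y).
rewrite invr_gt0 c0 scalerA mulVf ?gt_eqF // scale1r => /(_ isT).
by rewrite mulrC ler_pdivlMr // mulrC.
Qed.

(* Witness: [q z = inf over t >= 0 of p (z + t y) - t p y]; the two bounds come
   from [t = 0] and [t = 1]. *)
Lemma sublinear_descent p y : sublinear p -> exists q,
  [/\ sublinear q, forall z, q z <= p z & q (- y) <= - p y].
Proof.
move=> sp; have pZ t z : 0 <= t -> p (t *: z) = t * p z.
  rewrite le_eqVlt => /predU1P[<-|/sp.2//].
  by rewrite scale0r mul0r sublinear0.
have [||||q [sq qle]] := @sublinear_inf R [set t | 0 <= t]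
    (fun t z => p (z + t *: y) - t * p y) (fun z => - p (- z)).
- by exists 0 => /=.
- move=> t z /= t0; rewrite -(pZ _ _ t0).
  have := sp.1 (z + t *: y) (- z); rewrite addrAC subrr add0r; lra.
- move=> s t z w /= s0 t0; exists (s + t); first exact: addr_ge0.
  have := sp.1 (z + s *: y) (w + t *: y).
  by rewrite addrACA -scalerDl; lra.
- move=> s c z /= s0 c0; exists (c * s); first by rewrite mulr_ge0 // ltW.
  by rewrite -scalerA -scalerDr sp.2 //; lra.
exists q; split=> //.
- by move=> z; have := qle 0 z (lexx _); rewrite scale0r addr0 mul0r subr0.
- by have := qle 1 (- y) ler01; rewrite scale1r mul1r addNr sublinear0 // sub0r.
Qed.

Lemma minimal_sublinear q : sublinear q -> exists p,
  [/\ sublinear p, forall y, p y <= q y &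
      forall p', sublinear p' -> (forall y, p' y <= p y) -> p' = p].
Proof.
move=> sq; pose T := {p | sublinear p /\ forall y, p y <= q y}.
(* The order is reversed, so that a maximal element for Zorn's lemma is a minimal sublinear
   functional. *)
pose le (s t : T) := `[< forall y, sval t y <= sval s y >].
have [||||[p [sp pq]] pmin] := @Zorn T le.
- by move=> t; apply/asboolP.
- move=> r s t /asboolP rs /asboolP st; apply/asboolP => y.
  exact: le_trans (st y) (rs y).
- move=> [s Ps] [t Pt] /asboolP /= st /asboolP /= ts; apply: eq_exist.
  by apply/funext => y; apply/eqP; rewrite eq_le st ts.
- move=> A totA; have [[a Aa]|nA] := pselect (A !=set0); last first.
    exists (exist _ q (conj sq (fun y => lexx (q y)))) => s As.
    by case: nA; exists s.
  have [||||p [sp pA]] := @sublinear_inf T A (fun t => sval t)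
      (fun y => - q (- y)).
  + by exists a.
  + move=> [t [st tq]] y At /=; apply: le_trans (sublinear_opp_ge y st).
    by rewrite lerN2.
  + move=> s t y z As At.
    have [st|st] : (forall y, sval t y <= sval s y) \/
        (forall y, sval s y <= sval t y).
      by case: (totA _ _ As At) => /asboolP; [left|right].
      exists t => //; apply: le_trans ((svalP t).1.1 _ _) _.
      exact: lerD.
    exists s => //; apply: le_trans ((svalP s).1.1 _ _) _.
    exact: lerD.
  + by move=> t c y At c0; exists t => //; rewrite (svalP t).1.2.
  have pq y : p y <= q y by apply: le_trans (pA a y Aa) ((svalP a).2 y).
  by exists (exist _ p (conj sp pq)) => s As; apply/asboolP => y /=; exact: pA.
exists p; split=> // p' sp' p'p.
have p'q y : p' y <= q y by apply: le_trans (p'p y) (pq y).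
have := pmin (exist _ p' (conj sp' p'q)).
by move=> H; have [] : exist _ p' (conj sp' p'q) = exist _ p (conj sp pq) :> T
  by apply: H; apply/asboolP.
Qed.

(** Functionals are plain functions, so that they are points of the product space to which
    Tychonoff's theorem applies. *)
Definition dual_ball : set (X -> R) := [set f |
  (forall a y z, f (a *: y + z) = a * f y + f z) /\ forall y, `|f y| <= `|y|].

(** A minimal sublinear functional is linear, since [sublinear_descent] cannot lower it any further.
    Starting from the descent of the norm along [y] forces the value at [y] to be the norm of
    [y]. *)
Lemma norming_functional y : exists2 f, dual_ball f & f y = `|y|.
Proof.
have snorm : sublinear (fun z : X => `|z|).
  split=> [z w|c z c0]; first exact: ler_normD.
  by rewrite normrZ gtr0_norm.
have [q [sq qle qy]] := sublinear_descent y snorm.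
have [p [sp pq pmin]] := minimal_sublinear sq.
have pN z : p (- z) = - p z.
  have [p' [sp' p'p p'z]] := sublinear_descent z sp.
  rewrite (pmin _ sp' p'p) in p'z.
  by have := sublinear_opp_ge z sp; lra.
have pD z w : p (z + w) = p z + p w.
  have := sp.1 z w; have := sp.1 (- z) (- w); rewrite -opprD !pN; lra.
have pZ c z : p (c *: z) = c * p z.
  have [c0|c0|->] := ltgtP c 0.
  - by rewrite -[c in LHS]opprK scaleNr pN sp.2 ?oppr_gt0 // mulNr opprK.
  - exact: sp.2.
  - by rewrite scale0r mul0r sublinear0.
have ple z : p z <= `|z| by exact: le_trans (pq z) (qle z).
have pabs z : `|p z| <= `|z|.
  by rewrite ler_norml ple andbT lerNl -pN -(normrN z).
exists p; first by split=> // a z w; rewrite pD pZ.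
apply/eqP; rewrite eq_le ple /= -lerN2 -pN.
exact: le_trans (pq _) qy.
Qed.

End HahnBanach.

(** * Weak* compactness of the dual ball *)

Lemma near_forall_lt (T : Type) (F : set_system T) (P : nat -> T -> Prop) (r : nat) :
  Filter F -> (forall k, (k < r)%N -> \forall z \near F, P k z) ->
  \forall z \near F, forall k, (k < r)%N -> P k z.
Proof.
move=> FF; elim: r => [|m IH] H; first by near=> z.
have Hm : \forall z \near F, forall k, (k < m)%N -> P k z.
  by apply: IH => k km; apply: H; exact: ltnW.
have HS := H m (leqnn _).
near=> z => k; rewrite ltnS leq_eqVlt => /predU1P[->|]; first by near: z.
by move: k; near: z.
Unshelve. all: by end_near. Qed.

Section DualBall.
Variables (R : realType) (X : normedModType R).

(** A sequence of functionals is coded as one function on [nat * X]. One use of Tychonoff's theorem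
    then suffices: linearity and the norm bound are closed conditions on finitely many
    evaluations. *)
Lemma dual_ball_families_compact :
  compact [set h : {ptws (nat * X)%type -> R} |
    forall k, dual_ball (fun y => h (k, y))].
Proof.
have cproj (i : nat * X) : continuous (fun h : {ptws (nat * X)%type -> R} => h i).
  exact: (@proj_continuous _ (fun=> R) i).
pose B := [set h : {ptws (nat * X)%type -> R} |
  forall i, `[- `|i.2|, `|i.2|]%classic (h i)].
have cB : compact B.
  by apply: (@tychonoff _ (fun=> R) (fun i : nat * X => `[- `|i.2|, `|i.2|]%classic)) => i;
    exact: segment_compact.
apply: subclosed_compact cB _; last first.
  by move=> h /= hb [k y] /=; rewrite in_itv /= -ler_norml; exact: (hb k).2.
have -> : [set h : {ptws (nat * X)%type -> R} |
      forall k, dual_ball (fun y => h (k, y))] =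
    (\bigcap_(i : nat * R * X * X) [set h |
      h (i.1.1.1, i.1.1.2 *: i.1.2 + i.2) - i.1.1.2 * h (i.1.1.1, i.1.2) -
      h (i.1.1.1, i.2) = 0]) `&`
    (\bigcap_(i : nat * X) [set h | `|h i| <= `|i.2|]).
  apply/seteqP; split=> [h hb|h [h1 h2] k].
    split=> [[[[k a] y] z] _|[k y] _] /=; last exact: (hb k).2.
    by rewrite (hb k).1; ring.
  split=> [a y z|y]; last exact: (h2 (k, y)).
  by have /= := h1 (k, a, y, z) I; lra.
apply: closedI; apply: closed_bigI => i _.
  apply: (@closed_comp _ _ _ [set x | x = 0]) => [h _|]; last exact: closed_eq.
  exact: (cvgB (cvgB (cproj (i.1.1.1, i.1.1.2 *: i.1.2 + i.2) h)
    (cvgM (cvg_cst i.1.1.2) (cproj (i.1.1.1, i.1.2) h))) (cproj (i.1.1.1, i.2) h)).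
apply: (@closed_comp _ _ _ [set x | x <= `|i.2|]) => [h _|]; last exact: closed_le.
exact: (cvg_norm (cproj i h)).
Qed.

Lemma dual_ball_weakly_null (y : nat -> X) (f : X -> R) : weakly_null y ->
  dual_ball f -> f (y n) @[n --> \oo] --> (0 : R).
Proof.
move=> wy [flin fle].
pose fL := HB.pack_for {linear X -> R^o} (f : X -> R^o)
  (GRing.isLinear.Build R X R^o _ (f : X -> R^o) flin).
apply: (wy fL); apply/linear_bounded_continuous/linear_boundedP.
near=> r => z; apply: le_trans (fle z) _.
by rewrite ler_peMl //; near: r; exact: nbhs_pinfty_ge.
Unshelve. all: by end_near. Qed.

Lemma perfect_sequence (A : set dyadic) : perfect A -> exists c : nat -> dyadic,
  (forall i, A (c i)) /\ forall i, strict_prefix (c i) (c i.+1).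
Proof.
move=> [[a0 Aa0] sA].
have /choice[g gP] : forall a, exists u, A a -> A u /\ strict_prefix a u.
  move=> a; have [/sA[u [_ [[Au au] _ _ _]]]|nA] := pselect (A a); first by exists u.
  by exists a.
exists (fun i => iter i g a0).
have cA i : A (iter i g a0) by elim: i => //= i /gP[].
by split=> // i; have [] := gP _ (cA i).
Qed.

Variable x : dyadic -> X.
Hypothesis x_weakly_null : forall (beta : set dyadic) (s : nat -> dyadic),
  chains setT beta -> increasing_enum beta s -> weakly_null (fun i => x (s i)).

Lemma increasing_lt (c : nat -> dyadic) :
  (forall i, strict_prefix (c i) (c i.+1)) ->
  forall i j, (i < j)%N -> strict_prefix (c i) (c j).
Proof.
move=> cS i j; elim: j => // j IH; rewrite ltnS leq_eqVlt => /predU1P[->//|/IH].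
by move=> /strict_prefix_trans; apply.
Qed.

Lemma increasing_inj (c : nat -> dyadic) :
  (forall i, strict_prefix (c i) (c i.+1)) -> injective c.
Proof.
move=> cS i j cij; apply: contrapT => nij; wlog ij : i j cij nij / (i < j)%N.
  by move=> H; case: (ltngtP i j) => // ?; [exact: (H i j)|apply: (H j i) => // /esym].
by have := increasing_lt cS ij; rewrite cij strict_prefix_irr.
Qed.

Lemma dual_ball_cvg0 (c : nat -> dyadic) (f : X -> R) :
  (forall i, strict_prefix (c i) (c i.+1)) -> dual_ball f ->
  f (x (c i)) @[i --> \oo] --> (0 : R).
Proof.
move=> cS; apply: dual_ball_weakly_null; apply: (x_weakly_null (beta := range c)).
  split=> //.
    have cinj : {in [set: nat] &, injective c}.
      by move=> i j _ _; exact: increasing_inj.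
    by apply/infiniteP; rewrite (card_le_eqr (inj_card_eq cinj)) card_lexx.
  move=> _ _ [i _ <-] [j _ <-]; have [ij|ji|->] := ltngtP i j.
  - by left; apply: strict_prefixW; exact: increasing_lt.
  - by right; apply: strict_prefixW; exact: increasing_lt.
  - by left; rewrite prefix_refl.
by split.
Qed.

(* Compactness of the families [h] turns weak nullness along one infinite chain
   of [A] into a bound on the length of [c] valid for all of them. *)
Lemma common_small_node (A : set dyadic) (r : nat) (eps : R) :
  perfect A -> 0 < eps -> exists c : seq dyadic, [/\ c <> [::], chain_in A c &
    forall h : nat -> X -> R, (forall k, dual_ball (h k)) ->
      exists2 t, t \in c & forall k, (k < r)%N -> `|h k (x t)| <= eps].
Proof.
move=> pA e0; have [c [cA cS]] := perfect_sequence pA.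
have cproj (i : nat * X) : continuous (fun h : {ptws (nat * X)%type -> R} => h i).
  exact: (@proj_continuous _ (fun=> R) i).
(* The covering is indexed by the number [N] of the last node allowed; the covering property is
   monotone in [N], so compactness provides one [N] for all families. *)
have := dual_ball_families_compact; rewrite compact_near_coveringP.
move=> /(_ nat \oo (fun N h => exists2 i, (i <= N)%N &
    forall k, (k < r)%N -> `|h (k, x (c i))| < eps)) [|N _ cov].
- move=> h hb.
  have H k : \forall i \near \oo, `|h (k, x (c i))| < eps.
    by have /cvgr0_norm_lt := dual_ball_cvg0 cS (hb k); apply.
  have [N _ /(_ N (leqnn N)) HN] :=
    near_forall_lt (F := \oo) _ (fun k (_ : (k < r)%N) => H k).
  exists ([set h' | forall k, (k < r)%N -> `|h' (k, x (c N))| < eps],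
      [set M | (N <= M)%N]) => /=.
    split; last by exists N.
    apply: (@near_forall_lt _ (nbhs h)
      (fun k h' => `|h' (k, x (c N))| < eps)) => k kr.
    apply: open_nbhs_nbhs; split; last exact: HN.
    apply: (@open_comp _ _ _ [set z | z < eps]) => [h' _|]; last exact: open_lt.
    exact: (cvg_norm (cproj (k, x (c N)) h')).
  by move=> [h' M] /= [h'N NM]; exists N.
exists [seq c i | i <- iota 0 N.+1]; split=> //.
  split=> [|_ /mapP[i _ ->]]; last exact: cA.
  apply: (homo_sorted (e := ltn)) (iota_ltn_sorted 0 N.+1) => i j.
  exact: increasing_lt.
move=> h hb; have [i iN Oi] := cov N (leqnn N) (fun i => h i.1 i.2) hb.
exists (c i) => [|k kr]; last by apply: ltW; exact: Oi.
by apply: map_f; rewrite mem_iota /= add0n ltnS.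
Unshelve. all: by end_near. Qed.

End DualBall.

(** * Witnesses that are small off their chain *)

Lemma thin_shift (B : seq dyadic -> Prop) s : thin B -> thin (fun s' => B (s ++ s')).
Proof. by move=> tB s1 s2 B1; rewrite catA => /(tB _ _ B1). Qed.

Section Matching.
Variables (R : realType) (X : normedModType R) (x : dyadic -> X).
Hypothesis x_weakly_null : forall (beta : set dyadic) (s : nat -> dyadic),
  chains setT beta -> increasing_enum beta s -> weakly_null (fun i => x (s i)).
Variables (B : nat -> seq dyadic -> Prop) (Q : nat -> seq dyadic -> (X -> R) -> Prop).
Variable (eps : nat -> R).
Hypotheses (thinB : forall j, thin (B j)) (eps_gt0 : forall i, 0 < eps i).
Hypothesis BQ : forall j s, B j s -> exists2 f, dual_ball f & Q j s f.

(** The first [j] nodes are exempt: a node placed at position [k] then has to serve only the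
    finitely many scales [j <= k]. *)
Definition small_off (j : nat) (p s : seq dyadic) (f : X -> R) : Prop :=
  forall i, (j <= i < size p)%N -> nth [::] p i \notin s ->
    `|f (x (nth [::] p i))| <= eps i.

(** The chain is split into [s], already on the path, and a future [s'] in the reservoir. The
    witness may depend on [s'], but its smallness concerns the path only. *)
Definition matching (p : seq dyadic) (A : set dyadic) : Prop :=
  forall j s s', subseq s (drop j p) -> chain_in A s' -> B j (s ++ s') ->
    exists f, [/\ dual_ball f, Q j (s ++ s') f & small_off j p s f].

Lemma matching_sub p A A' : matching p A -> A' `<=` A -> matching p A'.
Proof. by move=> mp sub j s s' sp /(chain_inS sub); exact: mp sp. Qed.

(** For each scale, each past chain [s] and each candidate node [t], Ramsey makes uniform over all
    futures whether some witness is also small at [t]. One witness per pair [(j, s)] is fixed for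
    some future; [common_small_node] finds a candidate where all of these are small, which excludes
    the negative alternative for it. *)
Lemma matching_step p A : perfect A -> matching p A -> exists t C,
  [/\ A t, perfect C, C `<=` above A t & matching (rcons p t) C].
Proof.
move=> pA mp.
pose k := size p.
pose l := [seq (j, s) | j <- iota 0 k.+1, s <- subseqs (drop j p)].
have mem_l j s : (j <= k)%N -> subseq s (drop j p) -> (j, s) \in l.
  move=> jk sp; apply/allpairsPdep; exists j, s; split=> //.
    by rewrite mem_iota add0n ltnS.
  by rewrite mem_subseqs.
have l_sub j s : (j, s) \in l -> subseq s (drop j p).
  by case/allpairsPdep => j' [s' [_ + [-> ->]]]; rewrite mem_subseqs.
have [c [c0 cA small]] := common_small_node x_weakly_null (size l) pA (eps_gt0 k).
have cl : last [::] c \in c by case: (c) c0 => //= a c' _; exact: mem_last.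
pose G (q : nat * seq dyadic * dyadic) (s' : seq dyadic) := exists f,
  [/\ dual_ball f, Q q.1.1 (q.1.2 ++ s') f, small_off q.1.1 p q.1.2 f &
      `|f (x q.2)| <= eps k].
(* Futures are taken above the last candidate, hence above whichever candidate is finally chosen. *)
have pA1 : perfect (above A (last [::] c)) by apply: perfect_above => //; exact: cA.2.
have [q _|U [pU UA1 homog]] := @chain_ramsey_seq _ [seq (r, t) | r <- l, t <- c]
    (fun q s' => B q.1.1 (q.1.2 ++ s')) G _ _ pA1.
  exact/thin_shift/thinB.
have UA : U `<=` A by move=> u /UA1[].
(* A pair without a possible future gets an arbitrary functional of the dual ball. *)
have /choice[h hP] : forall i : nat, exists f, dual_ball f /\
    let q := nth (0%N, [::]) l i in (i < size l)%N ->
    (exists2 s', chain_in U s' & B q.1 (q.2 ++ s')) ->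
    exists s', [/\ chain_in U s', B q.1 (q.2 ++ s'), Q q.1 (q.2 ++ s') f &
      small_off q.1 p q.2 f].
  move=> i; set q := nth _ _ _.
  have [[il [s' cs' Bs']]|no] := pselect ((i < size l)%N /\
      exists2 s', chain_in U s' & B q.1 (q.2 ++ s')).
    have ql : subseq q.2 (drop q.1 p).
      by apply: l_sub; rewrite -surjective_pairing mem_nth.
    have [f [df Qf sf]] := mp _ _ _ ql (chain_inS UA cs') Bs'.
    by exists f; split=> //= _ _; exists s'.
  have [f df _] := @norming_functional R X 0.
  by exists f; split=> //= il ex; case: no; split.
have [t tc ht] := small h (fun k => (hP k).1).
have good j s s' : (j <= k)%N -> subseq s (drop j p) -> chain_in U s' ->
    B j (s ++ s') -> G (j, s, t) s'.
  move=> jk sp cs' Bs'; have jsl := mem_l _ _ jk sp.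
  have [|all_good|none_good] := homog (j, s, t); first exact: allpairs_f.
    exact: all_good.
  have il : (index (j, s) l < size l)%N by rewrite index_mem.
  have [df] := hP (index (j, s) l); rewrite /= nth_index // => /(_ il) [].
    by exists s'.
  move=> s'' [cs'' Bs'' Qf sf]; exfalso; apply: (none_good s'' cs'' Bs'').
  by exists (h (index (j, s) l)); split=> //; exact: ht.
have Ut : U `<=` above A t.
  move=> u /UA1[Au cu]; split=> //; apply: strict_prefix_lt_trans cu.
  exact: sorted_le_last cA.1 tc.
exists t, U; split=> //; first exact: cA.2.
move=> j s s' sp cs' Bs'.
have [jk|kj] := leqP j k; last first.
  have [f df Qf] := BQ Bs'; exists f; split=> // i.
  by rewrite size_rcons -/k; lia.
move: sp; rewrite drop_rcons // => /subseq_rcons[sp|[s1 es s1p]].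
  have [f [df Qf sf /= ft]] := good _ _ _ jk sp cs' Bs'.
  exists f; split=> // i; rewrite size_rcons ltnS => /andP[ji].
  rewrite leq_eqVlt nth_rcons -/k => /predU1P[->|ik]; first by rewrite ltnn eqxx.
  by rewrite ik; apply: sf; rewrite ji.
(* If the past chain ends in [t], then [t :: s'] was already a future for [A], and nothing is asked
   of the witness at [t]. *)
rewrite es cat_rcons in Bs' *.
have cts : chain_in A (t :: s').
  apply/chain_in_cons; split; first exact: cA.2.
  exact: chain_inS Ut cs'.
have [f [df Qf sf]] := mp _ _ _ s1p cts Bs'.
exists f; split=> // i; rewrite size_rcons ltnS => /andP[ji].
rewrite leq_eqVlt nth_rcons -/k => /predU1P[->|ik].
  by rewrite ltnn eqxx mem_rcons mem_head.
rewrite ik mem_rcons in_cons negb_or => /andP[_ ins1].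
by apply: sf; rewrite ?ji.
Qed.

Lemma matching_tree : exists T, subtree T /\
  forall s, chain_in T s -> s <> [::] ->
    exists p, [/\ sorted strict_prefix p, subseq s p &
      forall j s', subseq s' (drop j p) -> B j s' ->
        exists f, [/\ dual_ball f, Q j s' f & small_off j p s' f]].
Proof.
have [||||T [_ _ sT Tpath]] := @fusion matching setT.
- by move=> q A; exact: matching_step.
- by move=> q A A' mq _; exact: matching_sub.
- exact: perfect_setT.
- by move=> j s s' _ _ /BQ[f df Qf]; exists f; split=> // i; rewrite andbF.
exists T; split=> // s cs s0; have [p [sp sub mp]] := Tpath s cs s0.
exists p; split=> // j s' s'p Bs'.
have := mp j s' [::] s'p; rewrite cats0; apply=> //.
Qed.

End Matching.

(** * The near-unconditionality inequality *)

Section Elton.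
Variables (R : realType) (X : normedModType R) (x : dyadic -> X).
Hypothesis x_normalized : forall s, `|x s| = 1.

Definition positive_witness (sigma : R) (s : seq dyadic) (f : X -> R) : Prop :=
  (forall t, t \in s -> 0 <= f (x t)) /\ sigma <= \sum_(t <- s) f (x t).

Definition feasible (sigma : R) (s : seq dyadic) : Prop :=
  exists2 f, dual_ball f & positive_witness sigma s f.

Definition critical (sigma : R) (s : seq dyadic) : Prop :=
  feasible sigma s /\
  forall s1 s2, s = s1 ++ s2 -> s2 <> [::] -> ~ feasible sigma s1.

Lemma critical_thin sigma : thin (critical sigma).
Proof.
move=> s s' [fs _] [_ crit]; apply: contrapT => s'0.
exact: crit (erefl _) s'0 fs.
Qed.

Lemma feasible_critical sigma s : feasible sigma s ->
  exists s1 s2, s = s1 ++ s2 /\ critical sigma s1.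
Proof.
have [n] := ubnP (size s); elim: n s => // n IH s sn fs.
have [[s1 [s2 [es s20 fs1]]]|crit] := pselect (exists s1 s2,
    [/\ s = s1 ++ s2, s2 <> [::] & feasible sigma s1]).
  have [|s3 [s4 [es1 c3]]] := IH s1 _ fs1.
    move: sn; rewrite es size_cat; case: (s2) s20 => //= a s3 _; lia.
  by exists s3, (s4 ++ s2); rewrite es es1 catA.
exists s, [::]; rewrite cats0; split=> //; split=> // s1 s2 es s20 fs1.
by apply: crit; exists s1, s2.
Qed.

Lemma dual_ball_sum (f : X -> R) (p : seq dyadic) (P : pred dyadic) (b : dyadic -> R) :
  dual_ball f ->
  f (\sum_(t <- p | P t) b t *: x t) = \sum_(t <- p | P t) b t * f (x t).
Proof.
move=> [flin _]; have f0 : f 0 = 0 by have := flin 1 0 0; rewrite scaler0 add0r; lra.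
have fD y z : f (y + z) = f y + f z by rewrite -[y]scale1r flin mul1r scale1r.
have fZ c y : f (c *: y) = c * f y by rewrite -[c *: y]addr0 flin f0 addr0.
by rewrite (big_morph f fD f0); apply: eq_bigr => t _.
Qed.

Lemma dual_ball_le1 (f : X -> R) t : dual_ball f -> `|f (x t)| <= 1.
Proof. by move=> [_ /(_ (x t))]; rewrite x_normalized. Qed.

Lemma dual_ball_opp (f : X -> R) : dual_ball f -> dual_ball (fun y => - f y).
Proof.
by move=> [fl fb]; split=> [a y z|y]; [rewrite fl; ring|rewrite normrN].
Qed.

Lemma critical1 t : critical 1 [:: t].
Proof.
have [f df ft] := norming_functional (x t); rewrite x_normalized in ft.
split.
  exists f => //; split=> [u|]; last by rewrite big_seq1 ft.
  by rewrite inE => /eqP ->; rewrite ft.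
case=> [|u s1] s2 /(congr1 size) /=; last by rewrite size_cat; case: s2 => //=; lia.
by move=> _ _ [g _ [_]]; rewrite big_nil; lra.
Qed.

(** The exponents start at 2, so the total is at most 1/2, small enough to be absorbed in
    [coef_le_norm]. *)
Definition decay (i : nat) : R := 2^-1 ^+ i.+2.

Lemma decay_gt0 i : 0 < decay i.
Proof. by rewrite exprn_gt0 // invr_gt0. Qed.

Lemma sum_decay n : \sum_(i < n) decay i <= 2^-1.
Proof.
suff -> : \sum_(i < n) decay i = 2^-1 - 2^-1 ^+ n.+1.
  by rewrite lerBlDr lerDl exprn_ge0 // invr_ge0.
elim: n => [|n IH]; first by rewrite big_ord0 expr1 subrr.
by rewrite big_ord_recr /= IH /decay !exprS; field.
Qed.

(** * Estimates along a single path *)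

Section Path.
Variables (p : seq dyadic) (b : dyadic -> R).
Hypothesis p_sorted : sorted strict_prefix p.
Hypothesis p_matching : forall j s, subseq s (drop j p) -> critical (2 ^+ j) s ->
  exists f, [/\ dual_ball f, positive_witness (2 ^+ j) s f & small_off x decay j p s f].

Let norm := `|\sum_(t <- p) b t *: x t|.

Lemma p_uniq : uniq p.
Proof. exact: (sorted_uniq strict_prefix_trans strict_prefix_irr). Qed.

Lemma sum_subseq (s : seq dyadic) (F : dyadic -> R) : subseq s p ->
  \sum_(t <- p | t \in s) F t = \sum_(t <- s) F t.
Proof.
move=> sp; rewrite -big_filter; congr (\sum_(t <- _) _).
by move/(subseq_uniqP p_uniq): sp => {2}->.
Qed.

(** Each of the first [j] nodes costs at most 1, by normalization; the others cost at most 1/2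
    together. *)
Lemma sum_small_off j s f m : dual_ball f -> small_off x decay j p s f ->
  0 <= m -> (forall t, t \in p -> `|b t| <= m) ->
  `|\sum_(t <- p | t \notin s) b t * f (x t)| <= m * (j%:R + 2^-1).
Proof.
move=> df sf m0 bm; apply: le_trans (ler_norm_sum _ _ _) _.
rewrite (big_nth [::]) big_mkord.
have H (i : 'I_(size p)) : nth [::] p i \notin s ->
    `|b (nth [::] p i) * f (x (nth [::] p i))| <= m * ((i < j)%:R + decay i).
  move=> ns; rewrite normrM; apply: ler_pM => //; first by apply: bm; rewrite mem_nth.
  have [ij|ji] := ltnP i j.
    by apply: le_trans (dual_ball_le1 _ df) _; rewrite lerDl ltW ?decay_gt0.
  by rewrite add0r; apply: sf => //; rewrite ji /=.
apply: le_trans (ler_sum _ H) _.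
apply: (@le_trans _ _ (\sum_(i < size p) m * ((i < j)%:R + decay i))).
  rewrite big_mkcond /=; apply: ler_sum => i _; case: ifP => // _.
  by rewrite mulr_ge0 // addr_ge0 // ltW ?decay_gt0.
rewrite -mulr_sumr ler_wpM2l // big_split /= lerD ?sum_decay //.
rewrite -natr_sum ler_nat.
suff H' n : (\sum_(i < n) (i < j)%N <= minn n j)%N.
  by apply: leq_trans (H' _) (geq_minr _ _).
elim: n => [|n IH]; first by rewrite big_ord0.
rewrite big_ord_recr /=; apply: leq_trans (leq_add IH (leqnn _)) _.
by case: (ltnP n j) => nj; lia.
Qed.

Lemma norm_split f s : dual_ball f -> subseq s p ->
  `|\sum_(t <- s) b t * f (x t)| <=
    norm + `|\sum_(t <- p | t \notin s) b t * f (x t)|.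
Proof.
move=> df sp; have := df.2 (\sum_(t <- p) b t *: x t); rewrite dual_ball_sum //.
rewrite (bigID (mem s)) /= sum_subseq //; set u := \sum_(_ <- _) _.
set v := \sum_(_ <- _ | _) _ => uv.
have -> : u = (u + v) - v by rewrite addrK.
by apply: le_trans (ler_normB _ _) _; rewrite lerD2r.
Qed.

Lemma exists_max_coef : p <> [::] ->
  exists2 t, t \in p & forall u, u \in p -> `|b u| <= `|b t|.
Proof.
elim: (p) => // t q IH _; have [->|q0] := eqVneq q [::].
  by exists t => [|u]; rewrite inE // => /eqP ->.
have [u uq um] := IH (elimN eqP q0); have [le|/ltW le] := lerP `|b t| `|b u|.
  by exists u => [|v]; rewrite in_cons ?uq ?orbT // => /predU1P[->//|/um].
exists t => [|v]; rewrite in_cons ?eqxx // => /predU1P[->//|/um /le_trans]; exact.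
Qed.

(** At scale 1 no node is exempt. For a node with the largest coefficient, the witness of its
    singleton sees the remaining terms as at most half of that coefficient. *)
Lemma coef_le_norm t : t \in p -> `|b t| <= 2 * norm.
Proof.
move=> tp; have [|u up um] := exists_max_coef; first by move=> p0; rewrite p0 in tp.
have sub : subseq [:: u] p by rewrite sub1seq.
have [|f [df [_]]] := @p_matching 0 [:: u] _ (critical1 u); first by rewrite drop0.
rewrite big_seq1 => fu sf.
have := norm_split df sub; rewrite big_seq1 normrM => H1.
have := sum_small_off df sf (normr_ge0 (b u)) um; rewrite add0r => H2.
have H3 : `|b u| <= `|b u| * `|f (x u)|.
  by rewrite ler_peMr //; apply: le_trans fu (ler_norm _).
have := um t tp; lra.
Qed.

Hypothesis b_le1 : forall t, t \in p -> `|b t| <= 1.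

Lemma positive_sum_scale (delta : R) (G : pred dyadic) f j : dual_ball f ->
  (forall t, t \in p -> G t -> delta < b t /\ 0 <= f (x t)) -> 0 < delta ->
  2 ^+ j.+1 <= \sum_(t <- p | G t) f (x t) ->
  delta * 2 ^+ j <= norm + j.+1%:R.
Proof.
move=> df Gb d0 big.
pose s := [seq t <- drop j p | G t].
have sp : subseq s p by apply: subseq_trans (filter_subseq _ _) (drop_subseq _ _).
have G_s t : t \in s -> t \in p /\ G t.
  move=> ts; split; first exact: (mem_subseq sp).
  by move: ts; rewrite mem_filter => /andP[].
have fs : feasible (2 ^+ j) s.
  exists f => //; split=> [t /G_s[tp Gt]|]; first by have [] := Gb t tp Gt.
  (* Dropping the first [j] nodes loses at most [j <= 2 ^+ j], half of the assumed lower bound. *)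
  rewrite big_filter; move: big; rewrite -{1}(cat_take_drop j p) big_cat /=.
  have : \sum_(t <- take j p | G t) f (x t) <= j%:R.
    apply: (@le_trans _ _ (\sum_(t <- take j p) 1)).
      rewrite big_mkcond; apply: ler_sum => t _; case: ifP => // _.
      exact: le_trans (ler_norm _) (dual_ball_le1 t df).
    by rewrite big_const_seq iter_addr_0 count_predT ler_nat size_take; case: ltnP.
  have : j%:R <= 2 ^+ j :> R by rewrite -natrX ler_nat ltnW // ltn_expl.
  by rewrite exprS; lra.
have [s1 [s2 [es crit]]] := feasible_critical fs.
have s1d : subseq s1 (drop j p).
  by apply: subseq_trans (filter_subseq G _); rewrite -/s es prefix_subseq.
have s1p := subseq_trans s1d (drop_subseq _ _).
have [g [dg [g0 gs] sg]] := p_matching s1d crit.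
have H1 := norm_split dg s1p.
have H2 := sum_small_off dg sg ler01 b_le1.
have H3 : delta * 2 ^+ j <= \sum_(t <- s1) b t * g (x t).
  apply: (@le_trans _ _ (delta * \sum_(t <- s1) g (x t))); first by rewrite ler_pM2l.
  rewrite mulr_sumr !big_seq; apply: ler_sum => t ts.
  apply: ler_wpM2r; first exact: g0.
  have [|tp Gt] := G_s t; first by rewrite es mem_cat ts.
  by have [/ltW] := Gb t tp Gt.
have := ler_norm (\sum_(t <- s1) b t * g (x t)).
by rewrite -natr1; lra.
Qed.

Variables (delta : R) (j0 : nat).
Hypotheses (delta_gt0 : 0 < delta)
  (large_scale : forall j, (j0 <= j)%N -> 2 * j.+1%:R <= delta * 2 ^+ j).

Lemma positive_sum_le (G : pred dyadic) f : dual_ball f ->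
  (forall t, t \in p -> G t -> delta < b t /\ 0 <= f (x t)) ->
  \sum_(t <- p | G t) f (x t) <= 2 ^+ j0.+3 / delta * norm.
Proof.
move=> df Gb; set sigma := \sum_(_ <- _ | _) _.
have norm0 : 0 <= norm by exact: normr_ge0.
have pow1 n : 1 <= 2 ^+ n :> R by apply: exprn_ege1; rewrite ler1n.
have [/hasP[t tp Gt]|noG] := boolP (has G p); last first.
  rewrite /sigma big_hasC //; apply: mulr_ge0 => //.
  by rewrite divr_ge0 ?exprn_ge0 // ltW.
have dn : delta <= 2 * norm.
  have [dt _] := Gb t tp Gt; apply: le_trans (coef_le_norm tp).
  exact: le_trans (ltW dt) (ler_norm _).
rewrite mulrAC ler_pdivlMr //.
(* Below the threshold, [sigma] is bounded and [delta <= 2 * norm] is enough. *)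
have [small|big] := ltrP sigma (2 ^+ j0.+1).
  apply: (@le_trans _ _ (2 ^+ j0.+1 * delta)); first by rewrite ler_pM2r // ltW.
  apply: (@le_trans _ _ (2 ^+ j0.+1 * (2 * norm))); first by rewrite ler_pM2l ?exprn_gt0.
  by rewrite mulrA -exprSr ler_wpM2r // ler_weXn2l // ler1n.
have ex : exists n, sigma < 2 ^+ n.
  exists (Num.bound sigma); apply: lt_le_trans (archi_boundP _) _.
    by rewrite (le_trans _ big) // exprn_ge0.
  by rewrite -natrX ler_nat ltnW // ltn_expl.
(* The relevant scale is [j = n.-2], with [2 ^+ j.+1 <= sigma < 2 ^+ j.+2]. By [large_scale] the
   error [j.+1] is at most half of [delta * 2 ^+ j], whence [sigma * delta <= 8 * norm]; the 8
   accounts for the 3 in [j0.+3]. *)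
case: (ex_minnP ex) => n nP nmin.
have jn : (j0.+1 < n)%N.
  rewrite ltnNge; apply/negP => nj; have := lt_le_trans nP (le_trans _ big).
  rewrite ltxx => H; suff: false by []; apply: H.
  by rewrite ler_weXn2l // ler1n.
have en : n = n.-2.+2 by lia.
have sb : 2 ^+ n.-2.+1 <= sigma.
  by rewrite leNgt; apply/negP => /nmin; rewrite {1}en ltnn.
have H1 := positive_sum_scale df Gb delta_gt0 sb.
have H2 : 2 * n.-2.+1%:R <= delta * 2 ^+ n.-2 by apply: large_scale; lia.
have H3 : delta * 2 ^+ n.-2 <= 2 * norm by rewrite -/norm in H1; lra.
have H4 : sigma * delta <= 8 * norm.
  rewrite en !exprS in nP.
  apply: (@le_trans _ _ (2 * (2 * 2 ^+ n.-2) * delta)); first by rewrite ler_pM2r // ltW.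
  lra.
apply: le_trans H4 _; apply: ler_wpM2r => //.
have := pow1 j0; rewrite !exprS; lra.
Qed.

End Path.
End Elton.

(** * From paths to arbitrary chains *)

Lemma scale_threshold (R : realType) (delta : R) : 0 < delta ->
  exists j0, forall j, (j0 <= j)%N -> 2 * j.+1%:R <= delta * 2 ^+ j.
Proof.
move=> d0; exists (Num.bound (8 / delta)) => j j0.
(* With [j.+1 >= 8 / delta] this gives [8 * j.+1 <= delta * j.+1 ^ 2 <= 4 * delta * 2 ^ j]. *)
have sq : (j.+1 ^ 2 <= 4 * 2 ^ j)%N.
  elim: j {j0} => // -[|[|j]] // IH; rewrite (expnS 2 j.+2) mulnCA.
  by apply: leq_trans (leq_mul (leqnn 2) IH); rewrite -!mulnn; nia.
have H1 : j.+1%:R ^+ 2 <= 4 * 2 ^+ j :> R by rewrite -!natrX -natrM ler_nat.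
have H2 : 8 <= delta * j.+1%:R.
  rewrite mulrC -ler_pdivrMr //; apply: ltW.
  apply: lt_le_trans (archi_boundP _) _; first by rewrite divr_ge0 // ltW.
  by rewrite ler_nat leqW.
have H3 : 0 <= j.+1%:R :> R by [].
have H4 : 8 * j.+1%:R <= delta * j.+1%:R ^+ 2 by rewrite expr2 mulrA ler_wpM2r.
have H5 : delta * j.+1%:R ^+ 2 <= delta * (4 * 2 ^+ j) by rewrite ler_pM2l.
lra.
Qed.

(** For a functional [h] norming the partial sum, only terms where [b] and [h] agree in sign
    contribute positively, each at most the absolute value of [h]. The negative ones become positive
    for [- b] and [- h], because the matching hypothesis does not involve [b]; adding both halves
    doubles the constant. *)
Lemma near_unconditional_path (R : realType) (X : normedModType R) (x : dyadic -> X)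
    (p : seq dyadic) (b : dyadic -> R) (delta : R) (j0 : nat) (F : pred dyadic) :
  (forall s, `|x s| = 1) -> sorted strict_prefix p ->
  (forall j s, subseq s (drop j p) -> critical x (2 ^+ j) s -> exists f,
    [/\ dual_ball f, positive_witness x (2 ^+ j) s f & small_off x (decay R) j p s f]) ->
  (forall t, t \in p -> `|b t| <= 1) -> 0 < delta ->
  (forall j, (j0 <= j)%N -> 2 * j.+1%:R <= delta * 2 ^+ j) ->
  (forall t, t \in p -> F t -> delta < `|b t|) ->
  `|\sum_(t <- p | F t) b t *: x t| <=
    2 ^+ j0.+4 / delta * `|\sum_(t <- p) b t *: x t|.
Proof.
move=> x1 sp match_p b1 d0 scale Fb.
have [h dh <-] := norming_functional (\sum_(t <- p | F t) b t *: x t).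
rewrite dual_ball_sum //.
pose G1 t := [&& F t, 0 < b t & 0 <= h (x t)].
pose G2 t := [&& F t, b t < 0 & h (x t) <= 0].
have dNh := dual_ball_opp dh.
have H1 : \sum_(t <- p | G1 t) h (x t) <=
    2 ^+ j0.+3 / delta * `|\sum_(t <- p) b t *: x t|.
  apply: positive_sum_le => // t tp /and3P[Ft bt ht]; split=> //.
  by have := Fb t tp Ft; rewrite gtr0_norm.
have H2 : \sum_(t <- p | G2 t) - h (x t) <=
    2 ^+ j0.+3 / delta * `|\sum_(t <- p) b t *: x t|.
  have -> : `|\sum_(t <- p) b t *: x t| = `|\sum_(t <- p) (- b t) *: x t|.
    by rewrite -normrN -sumrN; congr `| _ |; apply: eq_bigr => t _; rewrite scaleNr.
  apply: (@positive_sum_le R X x x1 p (fun t => - b t) sp match_p _ delta j0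
    d0 scale G2 (fun y => - h y)) => // [t tp|t tp /and3P[Ft bt ht]].
    by rewrite normrN; exact: b1.
  by split; [have := Fb t tp Ft; rewrite ltr0_norm|rewrite oppr_ge0].
apply: (@le_trans _ _ (\sum_(t <- p | G1 t) h (x t) + \sum_(t <- p | G2 t) - h (x t))).
  rewrite big_mkcond [X in _ <= X + _]big_mkcond [X in _ <= _ + X]big_mkcond /=.
  rewrite -big_split /= big_seq [X in _ <= X]big_seq; apply: ler_sum => t tp.
  have := b1 t tp; rewrite ler_norml => /andP[bl bu].
  rewrite /G1 /G2; case: (F t) => /=; last by rewrite addr0.
  by case: (ltrP 0 (b t)) => ?; case: (ltrP (b t) 0) => ?;
    case: (lerP 0 (h (x t))) => ?; case: (lerP (h (x t)) 0) => ? /=; nra.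
by rewrite [2 ^+ j0.+4]exprS; lra.
Qed.

Theorem theorem4p1 (R : realType) (X : completeNormedModType R)
    (x : dyadic -> X)
    (x_normalized : forall s, `|x s| = 1)
    (x_weakly_null : forall (beta : set dyadic) (s : nat -> dyadic),
       chains setT beta -> increasing_enum beta s ->
       weakly_null (fun i => x (s i))) :
  exists T : set dyadic, subtree T /\
    forall delta : R, 0 < delta ->
      exists C : R, 0 < C /\
        forall (beta : set dyadic) (s : nat -> dyadic),
          chains T beta -> increasing_enum beta s ->
          forall (n : nat) (a : 'I_n -> R),
            (forall i, -1 <= a i <= 1) ->
            forall F : {set 'I_n}, (forall i, i \in F -> delta < `|a i|) ->
              `| \sum_(i in F) a i *: x (s i) |
                <= C * `| \sum_(i < n) a i *: x (s i) |.
Proof.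
have [T [sT Tpath]] := @matching_tree R X x x_weakly_null
  (fun j => critical x (2 ^+ j)) (fun j => positive_witness x (2 ^+ j)) (decay R)
  (fun j => @critical_thin _ _ x _) (@decay_gt0 R) (fun j s c => c.1).
(* The tree serves all scales at once; [delta] enters only through the threshold [j0]. *)
exists T; split=> // delta d0; have [j0 scale] := scale_threshold d0.
exists (2 ^+ j0.+4 / delta); split; first by rewrite divr_gt0 ?exprn_gt0.
move=> beta s [bT _ _] [s_lt s_beta] n a a1 F Fa.
have [n0|n0] := posnP n.
  by move: a a1 F Fa; rewrite n0 => a _ F _; rewrite !big1 ?normr0 ?mulr0 // => -[].
pose c := [seq s (val i) | i <- enum 'I_n].
have cE : c = [seq s i | i <- iota 0 n] by rewrite -val_enum_ord -map_comp.
have cT : chain_in T c.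
  split; last by move=> _ /mapP[i _ ->]; apply: bT; rewrite -s_beta; exists (val i).
  rewrite cE; apply: (homo_sorted (e := ltn)) (iota_ltn_sorted 0 n) => i j.
  exact: increasing_lt.
have c0 : c <> [::] by move=> /(congr1 size); rewrite cE size_map size_iota /=; lia.
have [p [sp cp match_p]] := Tpath c cT c0.
have s_inj := increasing_inj s_lt.
(* The coefficients are moved to nodes and vanish off the chain, so the sums over the chain become
   sums over the whole path [p], to which the path estimate applies. *)
pose b t := \sum_(i < n | s i == t) a i.
pose F' t := [exists i : 'I_n, (s i == t) && (i \in F)].
have bs (i : 'I_n) : b (s i) = a i.
  by rewrite /b (big_pred1 i) // => k; rewrite (inj_eq s_inj) (inj_eq val_inj).
have Fs (i : 'I_n) : F' (s i) = (i \in F).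
  apply/existsP/idP => [[k /andP[/eqP /s_inj /val_inj <-]]//|iF].
  by exists i; rewrite eqxx.
have b0 t : t \notin c -> b t = 0.
  move=> tc; rewrite /b big_pred0 // => i; apply/eqP => e; case/negP: tc.
  by rewrite -e; apply: (map_f (s \o val)); rewrite mem_enum.
have sumE (P : pred dyadic) :
    \sum_(t <- p | P t) b t *: x t = \sum_(i < n | P (s i)) a i *: x (s i).
  rewrite (bigID (mem c)) /= [X in _ + X]big1 ?addr0; last first.
    by move=> t /andP[_ /b0 ->]; rewrite scale0r.
  under eq_bigl do rewrite andbC; rewrite -big_filter_cond.
  have -> : [seq t <- p | t \in c] = c.
    by move/(subseq_uniqP (p_uniq sp)): cp => {2}->.
  by rewrite big_map big_enum_cond /=; apply: eq_bigr => i _; rewrite bs.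
have c_mem t : t \in c -> exists i : 'I_n, t = s i.
  by case/mapP => i _ ->; exists i.
have := @near_unconditional_path R X x p b delta j0 F' x_normalized sp match_p _ d0 scale _.
rewrite (sumE F') (sumE xpredT) (eq_bigl _ _ Fs); apply.
- move=> t _; have [/c_mem[i ->]|/b0 ->] := boolP (t \in c).
    by rewrite bs ler_norml.
  by rewrite normr0.
- by move=> t _ /existsP[i /andP[/eqP <- iF]]; rewrite bs; exact: Fa.
Qed.
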